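(* For any integer $n\geq 0$, we have $q_e(n)=q_a(n)=n\,q(n-1)$ and $q_{ea}(n)=n(n-1)\,q(n-2)$, where the right-hand sides are read as $0$ when the factor $n$, respectively $n(n-1)$, is $0$.
   Context: Let $X_n=\{1,\ldots,n\}$. An operation $F\colon X_n^2\to X_n$ is associative if $F(F(x,y),z)=F(x,F(y,z))$ for all $x,y,z$, and quasitrivial if $F(x,y)\in\{x,y\}$ for all $x,y$. An element $e$ is a neutral element of $F$ if $F(x,e)=F(e,x)=x$ for all $x$; an element $a$ is an annihilator element of $F$ if $F(x,a)=F(a,x)=a$ for all $x$. For $n\geq 1$: $q(n)$ is the number of associative and quasitrivial operations $F\colon X_n^2\to X_n$; $q_e(n)$ is the number of those that have a neutral element; $q_a(n)$ is the number of those that have an annihilator element; $q_{ea}(n)$ is the number of those that have distinct neutral and annihilator elements. By convention $q(0)=1$ and $q_e(0)=q_a(0)=q_{ea}(0)=0$. *)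

(* Defs.v *)
From mathcomp Require Import all_boot.

Set Implicit Arguments.
Unset Strict Implicit.
Unset Printing Implicit Defensive.

(* X_n = {1, ..., n} is represented by 'I_n = {0, ..., n-1}; only the
   cardinality of the carrier matters for the predicates below. *)
Notation binop n := {ffun 'I_n * 'I_n -> 'I_n}.

Section Predicates.
Variable n : nat.
Implicit Types (F : binop n) (e a : 'I_n).

Definition is_assoc F : bool :=
  [forall x, forall y, forall z, F (F (x, y), z) == F (x, F (y, z))].

Definition quasitrivial F : bool :=
  [forall x, forall y, (F (x, y) == x) || (F (x, y) == y)].

Definition neutral F e : bool :=
  [forall x, (F (x, e) == x) && (F (e, x) == x)].

Definition annihilator F a : bool :=
  [forall x, (F (x, a) == a) && (F (a, x) == a)].

Lemma is_assocP F : reflect (associative (fun x y => F (x, y))) (is_assoc F).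
Proof.
apply: (iffP idP) => [/forallP h x y z | h].
  by move/forallP: (h x) => /(_ y)/forallP/(_ z)/eqP->.
by apply/forallP=> x; apply/forallP=> y; apply/forallP=> z; rewrite -h.
Qed.

Lemma quasitrivialP F :
  reflect (forall x y, F (x, y) = x \/ F (x, y) = y) (quasitrivial F).
Proof.
apply: (iffP idP) => [/forallP h x y | h].
  by move/forallP: (h x) => /(_ y)/orP[]/eqP; [left | right].
apply/forallP=> x; apply/forallP=> y; apply/orP.
by case: (h x y) => ->; [left | right].
Qed.

Lemma neutralP F e :
  reflect (right_id e (fun x y => F (x, y)) /\ left_id e (fun x y => F (x, y)))
          (neutral F e).
Proof.
apply: (iffP idP) => [/forallP h | [hr hl]].
  by split=> x; case/andP: (h x) => /eqP ? /eqP.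
by apply/forallP=> x; rewrite hr hl eqxx.
Qed.

Lemma annihilatorP F a :
  reflect (right_zero a (fun x y => F (x, y)) /\
           left_zero a (fun x y => F (x, y)))
          (annihilator F a).
Proof.
apply: (iffP idP) => [/forallP h | [hr hl]].
  by split=> x; case/andP: (h x) => /eqP ? /eqP.
by apply/forallP=> x; rewrite hr hl eqxx.
Qed.

End Predicates.

Definition q n : nat :=
  #|[set F : binop n | is_assoc F && quasitrivial F]|.

Definition q_e n : nat :=
  #|[set F : binop n | [&& is_assoc F, quasitrivial F &
                           [exists e, neutral F e]]]|.

Definition q_a n : nat :=
  #|[set F : binop n | [&& is_assoc F, quasitrivial F &
                           [exists a, annihilator F a]]]|.

Definition q_ea n : nat :=
  #|[set F : binop n | [&& is_assoc F, quasitrivial F &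
       [exists e, exists a, [&& e != a, neutral F e & annihilator F a]]]]|.

(* The conventions q(0) = 1 and q_e(0) = q_a(0) = q_ea(0) = 0 need no special
   case: there is exactly one operation on the empty set. *)
Lemma q0 : q 0 = 1.
Proof.
rewrite /q (_ : [set F | _] = setT); first by rewrite cardsT card_ffun card_prod !card_ord.
apply/setP=> F; rewrite !inE.
by apply/andP; split; apply/forallP; case.
Qed.

Lemma q_e0 : q_e 0 = 0.
Proof.
apply/eqP; rewrite cards_eq0 -subset0; apply/subsetP=> F.
by rewrite !inE => /and3P[_ _ /existsP[[]]].
Qed.

Lemma q_a0 : q_a 0 = 0.
Proof.
apply/eqP; rewrite cards_eq0 -subset0; apply/subsetP=> F.
by rewrite !inE => /and3P[_ _ /existsP[[]]].
Qed.

Lemma q_ea0 : q_ea 0 = 0.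
Proof.
apply/eqP; rewrite cards_eq0 -subset0; apply/subsetP=> F.
by rewrite !inE => /and3P[_ _ /existsP[[]]].
Qed.

(* Main.v *)
Require Import Defs.
From mathcomp Require Import all_boot.

Set Implicit Arguments.
Unset Strict Implicit.
Unset Printing Implicit Defensive.

(** Deleting a neutral (resp. annihilator) element [e] from an associative
    quasitrivial operation leaves an associative quasitrivial operation on the
    other elements, by quasitriviality; conversely a neutral (resp.
    annihilator) element can be adjoined in exactly one way.  Such an element
    being unique, summing over [e] gives the first two counts.  Adjoining a
    neutral element moreover preserves and reflects annihilators, so that
    q_ea(n) = n q_a(n-1). *)

Section Adjoin.
Variable n : nat.

(* The boolean selects a neutral ([true]) or an annihilator ([false]) element,
   so that both cases are treated at once. *)
Definition distinguished m (b : bool) (F : binop m) (e : 'I_m) : bool :=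
  if b then neutral F e else annihilator F e.

Lemma distinguishedP m b (F : binop m) e :
  reflect (forall x, F (x, e) = (if b then x else e) /\
                     F (e, x) = (if b then x else e))
          (distinguished b F e).
Proof.
by rewrite /distinguished; case: b; apply: (iffP forallP) => h x;
  [case/andP: (h x) => /eqP ? /eqP | case: (h x) => -> ->; rewrite eqxx
  |case/andP: (h x) => /eqP ? /eqP | case: (h x) => -> ->; rewrite eqxx].
Qed.

(** The value [F (e', e)] is prescribed twice, once by each element, and the two prescriptions are
    [e] and [e'] in some order. *)
Lemma distinguished_inj m b (F : binop m) e e' :
  distinguished b F e -> distinguished b F e' -> e = e'.
Proof.
move=> /distinguishedP/(_ e')[h _] /distinguishedP/(_ e)[_ h'].
by move: h; rewrite h'; case: b {h'}.
Qed.

Definition adjoin b (e : 'I_n.+1) (G : binop n) : binop n.+1 :=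
  [ffun p => match unlift e p.1, unlift e p.2 with
             | Some x, Some y => lift e (G (x, y))
             | None, _ => if b then p.2 else e
             | _, None => if b then p.1 else e
             end].

Variables (b : bool) (e : 'I_n.+1).
Implicit Types (F : binop n.+1) (G : binop n).

Lemma adjoin_lift G x y :
  adjoin b e G (lift e x, lift e y) = lift e (G (x, y)).
Proof. by rewrite ffunE /= !liftK. Qed.

Lemma adjoinl G x : adjoin b e G (e, x) = if b then x else e.
Proof. by rewrite ffunE /= unlift_none. Qed.

Lemma adjoinr G x : adjoin b e G (x, e) = if b then x else e.
Proof.
by rewrite ffunE /= unlift_none; case: unliftP => [j|] -> //; case: b.
Qed.

Lemma distinguished_adjoin G : distinguished b (adjoin b e G) e.
Proof. by apply/distinguishedP=> x; rewrite adjoinl adjoinr. Qed.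

(** Away from [e] the law is a copy of that of [G]. In a triple containing [e], a neutral [e] drops
    out of both bracketings, and an annihilating [e] turns both into [e]. *)
Lemma adjoin_assoc G : is_assoc (adjoin b e G) = is_assoc G.
Proof.
apply/is_assocP/is_assocP => h x y z.
  by apply: (@lift_inj _ e); rewrite -!adjoin_lift.
have adjE := (adjoinl, adjoinr, adjoin_lift).
case: (unliftP e x) => [x' ->|->]; case: (unliftP e y) => [y' ->|->];
  case: (unliftP e z) => [z' ->|->]; rewrite ?adjE ?h //;
  by case: b adjE => adjE; rewrite ?adjE.
Qed.

Lemma adjoin_quasitrivial G : quasitrivial (adjoin b e G) = quasitrivial G.
Proof.
apply/quasitrivialP/quasitrivialP => h x y.
  by case: (h (lift e x) (lift e y)); rewrite adjoin_lift => /lift_inj; auto.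
case: (unliftP e x) => [x' ->|->]; last by rewrite adjoinl; case: b; auto.
case: (unliftP e y) => [y' ->|->]; last by rewrite adjoinr; case: b; auto.
by rewrite adjoin_lift; case: (h x' y') => ->; auto.
Qed.

Lemma adjoin_inj : injective (adjoin b e).
Proof.
move=> G G' eqG; apply/ffunP=> -[x y].
by apply: (@lift_inj _ e); rewrite -!adjoin_lift eqG.
Qed.

Lemma adjoin_surj F : quasitrivial F -> distinguished b F e ->
  exists G, F = adjoin b e G.
Proof.
move=> /quasitrivialP qF /distinguishedP dF.
(* The default [p.1] is never reached: by quasitriviality [F] returns one of its two arguments, and
   both are lifted, hence differ from [e]. *)
exists [ffun p => odflt p.1 (unlift e (F (lift e p.1, lift e p.2)))].
apply/ffunP=> -[x y].
case: (unliftP e x) => [x' ->|->]; last by rewrite adjoinl (dF y).2.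
case: (unliftP e y) => [y' ->|->]; last by rewrite adjoinr (dF _).1.
by rewrite adjoin_lift ffunE /=; case: (qF (lift e x') (lift e y')) => ->;
  rewrite liftK.
Qed.

Lemma card_distinguished (P : pred (binop n.+1)) :
  #|[set F | [&& is_assoc F, quasitrivial F, distinguished b F e & P F]]| =
  #|[set G | [&& is_assoc G, quasitrivial G & P (adjoin b e G)]]|.
Proof.
rewrite -(card_imset _ adjoin_inj); apply: eq_card => F; rewrite inE.
apply/and4P/imsetP => [[aF qF dF pF] | [G]].
  have [G defF] := adjoin_surj qF dF; exists G => //.
  by rewrite inE -adjoin_assoc -adjoin_quasitrivial -defF aF qF.
rewrite inE => /and3P[aG qG pG] ->.
by rewrite adjoin_assoc adjoin_quasitrivial distinguished_adjoin.
Qed.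

End Adjoin.

Lemma annihilator_adjoin n e (G : binop n) a :
  annihilator (adjoin true e G) (lift e a) = annihilator G a.
Proof.
apply/annihilatorP/annihilatorP => -[hr hl]; split=> x.
- by apply: (@lift_inj _ e); rewrite -(adjoin_lift true) hr.
- by apply: (@lift_inj _ e); rewrite -(adjoin_lift true) hl.
- by case: (unliftP e x) => [y|] ->; rewrite ?adjoinl // adjoin_lift hr.
- by case: (unliftP e x) => [y|] ->; rewrite ?adjoinr // adjoin_lift hl.
Qed.

(** An annihilator other than [e] is a lift. The condition [e != a] matters when [n] is 0: on one
    point, [e] is both neutral and annihilating. *)
Lemma exists_annihilator_adjoin n e (G : binop n) :
  [exists a, (e != a) && annihilator (adjoin true e G) a] =
  [exists a, annihilator G a].
Proof.
apply/existsP/existsP => [[a /andP[]] | [a aG]].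
  by case: (unliftP e a) => [b|] ->; rewrite ?eqxx // annihilator_adjoin; exists b.
by exists (lift e a); rewrite neq_lift annihilator_adjoin.
Qed.

(** Uniqueness of the witness makes the sets indexed by [i] pairwise disjoint. *)
Lemma card_exists_unique (T I : finType) (S : T -> I -> bool) :
    (forall x i j, S x i -> S x j -> i = j) ->
  #|[set x | [exists i, S x i]]| = \sum_i #|[set x | S x i]|.
Proof.
move=> uniqS; under eq_bigr => i _ do rewrite -sum1_card.
rewrite -partition_disjoint_bigcup => [|i j neq_ij].
  rewrite sum1_card; apply: eq_card => x; rewrite inE.
  apply/existsP/bigcupP => [[i Si] | [i _]]; first by exists i; rewrite ?inE.
  by rewrite inE; exists i.
rewrite disjoints_subset; apply/subsetP=> x; rewrite !inE => Si.
by apply: contra neq_ij => Sj; apply/eqP/(uniqS x).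
Qed.

(** The side condition [P] may depend on [e], so that for [q_ea] it can demand an annihilator
    different from the neutral element. *)
Lemma card_exists_distinguished n b
    (P : 'I_n.+1 -> pred (binop n.+1)) (k : nat) :
    (forall e, #|[set G : binop n | [&& is_assoc G, quasitrivial G &
                                     P e (adjoin b e G)]]| = k) ->
  #|[set F : binop n.+1 | [&& is_assoc F, quasitrivial F &
                           [exists e, distinguished b F e && P e F]]]| =
  n.+1 * k.
Proof.
move=> cardP.
pose S F e :=
  [&& is_assoc F, quasitrivial F, distinguished b F e & P e F].
transitivity #|[set F | [exists e, S F e]]|.
  apply: eq_card => F; rewrite !inE /S.
  apply/and3P/existsP => [[-> ->] /existsP // | [e /and4P[-> -> dF pF]]].
  by split=> //; apply/existsP; exists e; rewrite dF.
rewrite card_exists_unique => [|F e e' /and4P[_ _ dF _] /and4P[_ _ dF' _]].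
  under eq_bigr => e _ do rewrite card_distinguished cardP.
  by rewrite sum_nat_const card_ord.
exact: distinguished_inj dF dF'.
Qed.

Lemma q_eS n : q_e n.+1 = n.+1 * q n.
Proof.
rewrite -(@card_exists_distinguished n true (fun _ => predT)) => [|e].
  apply: eq_card => F; rewrite !inE; congr [&& _, _ & _].
  by apply: eq_existsb => e; rewrite andbT.
by apply: eq_card => G; rewrite !inE andbT.
Qed.

Lemma q_aS n : q_a n.+1 = n.+1 * q n.
Proof.
rewrite -(@card_exists_distinguished n false (fun _ => predT)) => [|e].
  apply: eq_card => F; rewrite !inE; congr [&& _, _ & _].
  by apply: eq_existsb => e; rewrite andbT.
by apply: eq_card => G; rewrite !inE andbT.
Qed.

Lemma q_eaS n : q_ea n.+1 = n.+1 * q_a n.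
Proof.
rewrite -(@card_exists_distinguished n true
  (fun e F => [exists a, (e != a) && annihilator F a])) => [|e].
  apply: eq_card => F; rewrite !inE; congr [&& _, _ & _].
  apply: eq_existsb => e; apply/existsP/andP => [[a /and3P[ea eF aF]]|].
    by split=> //; apply/existsP; exists a; rewrite ea.
  by case=> eF /existsP[a /andP[ea aF]]; exists a; apply/and3P.
by apply: eq_card => G; rewrite !inE exists_annihilator_adjoin.
Qed.

(* The subtractions are truncated; whenever n - 1 or n - 2 is actually
   truncated, the factor n or n * (n - 1) in front of q is 0. *)
Theorem proposition4p2 (n : nat) :
  [/\ q_e n = n * q (n - 1),
      q_a n = n * q (n - 1) &
      q_ea n = n * (n - 1) * q (n - 2)].
Proof.
case: n => [|n]; first by rewrite q_e0 q_a0 q_ea0.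
rewrite q_eS q_aS q_eaS subSS subn0; split=> //.
(* On a one-element carrier both sides vanish, as [q_a 0] is 0; otherwise the recurrence for [q_a]
   applies once more. *)
by case: n => [|n]; rewrite ?q_a0 ?muln0 // q_aS mulnA !subSS !subn0.
Qed.
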